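(* Let $G$ and $H$ be graphs, each with at least $2$ vertices. The direct product $G\times H$ is $1$-perfectly orientable if and only if one of the following holds: (i) $G$ is a $1$-linear forest and $H$ is arbitrary, or vice versa; (ii) $G$ is a $2$-linear forest and $H$ is a pseudoforest, or vice versa; (iii) $G$ is a $3$-linear forest and $H$ is a $4$-linear forest, or vice versa.
   Context: All graphs are finite and simple. An orientation of a graph $G$ is $1$-perfect if the out-neighborhood of every vertex induces a clique in $G$; $G$ is $1$-perfectly orientable if it admits a $1$-perfect orientation. The direct product $G\times H$ has vertex set $V(G)\times V(H)$, with $(u,v),(u',v')$ adjacent iff $uu'\in E(G)$ and $vv'\in E(H)$. For a positive integer $k$, a $k$-linear forest is a disjoint union of paths each having at most $k$ vertices (so $1$-linear forests are edgeless graphs). A pseudoforest is a graph each of whose connected components contains at most one cycle. *)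

(* Defs.v *)
From mathcomp Require Import all_boot.
Set Implicit Arguments. Unset Strict Implicit. Unset Printing Implicit Defensive.

Definition simple_graph (T : finType) (e : rel T) : Prop :=
  symmetric e /\ irreflexive e.

Definition dprod_rel (T1 T2 : finType) (e1 : rel T1) (e2 : rel T2) : rel (T1 * T2) :=
  fun u v => e1 u.1 v.1 && e2 u.2 v.2.

Definition is_orientation (T : finType) (e : rel T) (D : rel T) : Prop :=
  (forall x y, D x y -> e x y) /\
  (forall x y, e x y -> (D x y && ~~ D y x) || (D y x && ~~ D x y)).

Definition one_perfect_orientation (T : finType) (e : rel T) (D : rel T) : Prop :=
  is_orientation e D /\
  (forall v x y, D v x -> D v y -> x != y -> e x y).

Definition one_perfectly_orientable (T : finType) (e : rel T) : Prop :=
  exists D : rel T, one_perfect_orientation e D.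

Definition seq_adj (T : eqType) (p : seq T) (x y : T) : Prop :=
  exists i, i.+1 < size p /\
    ((nth x p i = x /\ nth x p i.+1 = y) \/ (nth x p i = y /\ nth x p i.+1 = x)).

Definition k_linear_forest (k : nat) (T : finType) (e : rel T) : Prop :=
  exists s : seq (seq T),
    perm_eq (flatten s) (enum T) /\
    (forall p, p \in s -> size p <= k) /\
    (forall x y, e x y <-> exists2 p, p \in s & seq_adj p x y).

Definition is_cycle (T : finType) (e : rel T) (c : seq T) : Prop :=
  uniq c /\ 2 < size c /\ cycle e c.

Definition cycle_edge (T : eqType) (c : seq T) (x y : T) : bool :=
  (x \in c) && (y \in c) && ((next c x == y) || (next c y == x)).

(* pseudoforest: every connected component contains at most one cycle
   (cycles identified by their edge sets) *)
Definition pseudoforest (T : finType) (e : rel T) : Prop :=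
  forall c1 c2, is_cycle e c1 -> is_cycle e c2 ->
    (exists2 x, x \in c1 & exists2 y, y \in c2 & connect e x y) ->
    forall x y, cycle_edge c1 x y = cycle_edge c2 x y.

(* Main.v *)
(* If one factor is triangle-free, so is the product, and a 1-perfect orientation
   is then an orientation in which every vertex has outdegree at most one; in such
   an orientation the out-neighbour of a vertex of a cycle stays on that cycle.
   When both factors have a vertex of degree at least 2, comparing the 4-cycles
   through a given vertex excludes claws and nonbacktracking walks on 5 vertices
   from both factors, and nonbacktracking walks on 4 vertices from one of them;
   what remains are linear forests. When one factor is a nonempty matching, the
   product contains the double cover of the other factor, where two cycles of one
   component cannot both be closed under the orientation unless they are equal.
   Two triangles are excluded by counting in the product K3 x K3.
   Conversely pseudoforests have orientations of outdegree at most one, which lift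
   to the product with a matching, and the product of paths on 3 and 4 vertices is
   a disjoint union of unicyclic graphs. *)
Require Import Defs.
From mathcomp Require Import all_boot.
Set Implicit Arguments. Unset Strict Implicit. Unset Printing Implicit Defensive.

(** * Linear forests *)

Lemma flatten_uniq_inj (T : eqType) (s : seq (seq T)) p q x :
  uniq (flatten s) -> p \in s -> q \in s -> x \in p -> x \in q -> p = q.
Proof.
elim: s => //= r s IHs; rewrite cat_uniq => /and3P[_ /hasPn dis us].
have out p' : p' \in s -> x \in p' -> x \notin r.
  by move=> ps xp; apply: dis; apply/flattenP; exists p'.
rewrite !inE => /predU1P[->|ps] /predU1P[->|qs] xp xq //.
- by move: xp; rewrite (negPf (out q qs xq)).
- by move: xq; rewrite (negPf (out p ps xp)).
- exact: IHs.
Qed.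

Lemma seq_adj_index (T : eqType) (p : seq T) x y : uniq p -> seq_adj p x y ->
  [/\ x \in p, y \in p &
      (index y p == (index x p).+1) || (index x p == (index y p).+1)].
Proof.
move=> up [i [ip]].
have := index_uniq x (ltnW ip) up; have := mem_nth x (ltnW ip).
have := index_uniq x ip up; have := mem_nth x ip.
move: (nth x p i) (nth x p i.+1) => u v + + + + uv.
by case: uv => -[-> ->] -> -> -> ->; rewrite eqxx ?orbT.
Qed.

(** [pos x] is the index of [x] on its path. All neighbours of [x] lie on that path, so their
    indices tell them apart, and adjacency is reduced to arithmetic. *)
Lemma linear_forest_pos k (T : finType) (e : rel T) : k_linear_forest k e ->
  exists pos : T -> nat,
    [/\ forall x, pos x < k,
        forall x y, e x y -> (pos y == (pos x).+1) || (pos x == (pos y).+1) &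
        forall x y z, e x y -> e x z -> pos y = pos z -> y = z].
Proof.
case=> s [es [sk sadj]].
have us : uniq (flatten s) by rewrite (perm_uniq es) enum_uniq.
have ex_p x : exists2 p, p \in s & x \in p.
  by apply/flattenP; rewrite (perm_mem es) mem_enum.
pose P x := nth [::] s (find (fun p : seq T => x \in p) s).
have hasx x : has (fun p : seq T => x \in p) s by apply/hasP; exact: ex_p.
have PE p x : p \in s -> x \in p -> P x = p.
  move=> ps xp; apply: (flatten_uniq_inj us _ ps _ xp).
    by rewrite mem_nth // -has_find.
  exact: (@nth_find _ [::] (fun p : seq T => x \in p)).
have up p : p \in s -> uniq p.
  move: us; clear -s; elim: s => //= r s IHs; rewrite cat_uniq inE.
  by case/and3P=> ur _ us /predU1P[->|/IHs->].
exists (fun x => index x (P x)); split=> [x|x y|x y z].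
- have [p ps xp] := ex_p x; rewrite (PE _ _ ps xp).
  by apply: leq_trans (sk _ ps); rewrite index_mem.
- case/sadj=> p ps /(seq_adj_index (up _ ps))[xp yp].
  by rewrite (PE _ _ ps xp) (PE _ _ ps yp).
- case/sadj=> p ps /(seq_adj_index (up _ ps))[xp yp _].
  case/sadj=> q qs /(seq_adj_index (up _ qs))[xq zq _].
  have pq := flatten_uniq_inj us ps qs xp xq; subst q.
  rewrite (PE _ _ ps yp) (PE _ _ ps zq) => eq_yz.
  by rewrite -(nth_index y yp) eq_yz nth_index.
Qed.

(** * Acyclic claw-free graphs with short paths *)

Section LinearForest.
Variables (T : finType) (e : rel T) (k : nat).
Hypotheses (e_sym : symmetric e) (e_irr : irreflexive e).
Hypothesis acyclic : forall x p,
  path e x p -> uniq (x :: p) -> 1 < size p -> ~~ e (last x p) x.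
Hypothesis no_claw : forall x a b c,
  e x a -> e x b -> e x c -> [|| a == b, a == c | b == c].
Hypothesis short : forall p, sorted e p -> uniq p -> size p <= k.

(** A chord would close the segment of [p] between its ends to a cycle. *)
Lemma acyclic_nth p i j x0 : sorted e p -> uniq p -> i.+1 < j -> j < size p ->
  ~~ e (nth x0 p i) (nth x0 p j).
Proof.
move=> sp up ij jp; pose q := drop i (take j.+1 p).
have sq : size q = (j - i).+1 by rewrite size_drop size_takel // subSn // ltnW 1?ltnW.
have nq l : l <= j - i -> nth x0 q l = nth x0 p (i + l).
  by move=> lq; rewrite nth_drop nth_take // ltnS -leq_subRL // ltnW 1?ltnW.
have uq : uniq q by rewrite drop_uniq // take_uniq.
have srt : sorted e q by apply: drop_sorted; exact: take_sorted.
case Dq: q => [|x r]; first by rewrite Dq in sq.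
rewrite Dq /= in srt uq sq; case: sq => sr.
have := acyclic srt uq; rewrite sr e_sym ltn_subRL addn1 => /(_ ij).
have <- : nth x0 q (j - i) = last x r by rewrite Dq -sr (last_nth x0).
have <- : nth x0 q 0 = x by rewrite Dq.
by rewrite !nq // addn0 subnKC // ltnW 1?ltnW.
Qed.

(** A neighbour of [x] off the path would prolong it if [x] is an end, and give a claw if [x] is
    inner. A neighbour on the path is consecutive to [x] by acyclicity. *)
Lemma closed_maximal_path (A : {set T}) (p : seq T) :
    (forall x y, x \in A -> e x y -> y \in A) ->
    sorted e p -> uniq p -> {subset p <= A} ->
    (forall q, sorted e q -> uniq q -> {subset q <= A} -> size q <= size p) ->
  forall x y, x \in p -> e x y -> seq_adj p x y.
Proof.
move=> clA sp up pA maxp x y xp exy.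
have yA : y \in A by apply: clA exy; apply: pA.
have yp : y \in p.
  apply: contraT => ynp.
  have max' q : perm_eq q (y :: p) -> ~~ sorted e q.
    move=> qE; apply/negP => sq.
    have: size q <= size p; last by rewrite (perm_size qE) ltnn.
    apply: maxp => //; first by rewrite (perm_uniq qE) /= ynp.
    by move=> z; rewrite (perm_mem qE) inE => /predU1P[->|/pA].
  have ip : index x p < size p by rewrite index_mem.
  have xE : nth x p (index x p) = x by rewrite nth_index.
  case Di: (index x p) => [|i].
    have := max' (y :: p) (perm_refl _); rewrite Di in xE.
    by case: (p) xE sp => //= a r -> ->; rewrite e_sym exy.
  have [lti|gei] := ltnP i.+2 (size p); last first.
    have := max' (rcons p y); rewrite perm_rcons => /(_ (perm_refl _)).
    have: last x p = x.
      by rewrite -nth_last -[RHS]xE Di; congr nth; apply/eqP; rewrite -eqSS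
        prednK ?(leq_ltn_trans _ ip) // eqn_leq gei -Di.
    case: (p) xp sp => //= a r _ sr la.
    by rewrite rcons_path sr la exy.
  have adj := sortedP x sp.
  have eb := adj i.+1 lti; have ea := adj i (ltnW lti).
  rewrite -Di xE in eb ea; rewrite e_sym in ea.
  have := no_claw ea eb exy.
  rewrite Di nth_uniq ?(ltnW (ltnW lti)) // (ltn_eqF (leqnSn i.+1)) /=.
  by case/orP=> /eqP Dy; case/negP: ynp; rewrite -Dy mem_nth ?Di ?(ltnW (ltnW lti)).
have ip : index x p < size p by rewrite index_mem.
have jp : index y p < size p by rewrite index_mem.
have ne : index x p <> index y p.
  by move=> /(f_equal (nth x p)); rewrite !nth_index // => Dx; move: exy; rewrite Dx e_irr.
have := acyclic_nth (i := index x p) x sp up _ jp.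
have := acyclic_nth (i := index y p) x sp up _ ip.
rewrite !nth_index // exy e_sym exy.
case: (ltngtP (index x p) (index y p)) => // lt;
  [rewrite [_.+1 < index x p]ltnNge | rewrite [_.+1 < index y p]ltnNge].
- move=> _; case: (ltngtP (index x p).+1 (index y p)) lt => // [_ _ /(_ isT)//|Dy _ _].
  by exists (index x p); rewrite Dy; split=> //; left; rewrite !nth_index.
- case: (ltngtP (index y p).+1 (index x p)) lt => // [_ _ /(_ isT)//|Dy _ _ _].
  by exists (index y p); rewrite Dy; split=> //; right; rewrite !nth_index.
Qed.

Lemma sorted_seq_adj p x y : sorted e p -> seq_adj p x y -> e x y.
Proof.
move=> sp [i [ip xy]]; have := sortedP x sp i ip.
by case: xy => -[-> ->] //; rewrite e_sym.
Qed.

(** Induction peels off a longest path in [A]; no edge leaves it, so the rest of [A] is closed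
    again. *)
Lemma closed_linear_forest n (A : {set T}) : #|A| <= n ->
    (forall x y, x \in A -> e x y -> y \in A) ->
  exists s : seq (seq T),
    [/\ perm_eq (flatten s) (enum A), forall p, p \in s -> size p <= k,
        forall p, p \in s -> sorted e p &
        forall x y, x \in A -> e x y -> exists2 p, p \in s & seq_adj p x y].
Proof.
elim: n A => [|n IHn] A.
  rewrite leqn0 cards_eq0 => /eqP-> _.
  by exists [::]; split=> // [|x y]; rewrite ?enum_set0 ?inE.
move=> leA clA; have [->|[x0 x0A]] := set_0Vmem A.
  by exists [::]; split=> // [|x y]; rewrite ?enum_set0 ?inE.
(* Tuples make the existence of a path on [m] vertices a boolean; it forces [m <= #|T|], so a
   largest [m] exists. *)
pose good (q : seq T) := [&& sorted e q, uniq q & all (mem A) q].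
pose P m := [exists t : m.-tuple T, good t].
have PS q : good q -> P (size q).
  by move=> gq; apply/existsP; exists (in_tuple q).
have exP : exists m, P m.
  by exists 1; apply: (PS [:: x0]); rewrite /good /= x0A.
have ubP m : P m -> m <= #|T|.
  case/existsP=> t /and3P[_ ut _].
  by rewrite -(size_tuple t) -(card_uniqP ut) max_card.
case: (ex_maxnP exP ubP) => m /existsP[t] gt maxm.
have szt := size_tuple t; move: (tval t) gt szt => p /and3P[sp up /allP pA] szp.
have {}pA : {subset p <= A} := pA.
have adjp := closed_maximal_path clA sp up pA.
have {}adjp x y : x \in p -> e x y -> seq_adj p x y.
  apply: adjp => q sq uq qA; rewrite szp; apply/maxm/PS.
  by apply/and3P; split=> //; apply/allP.
have clp x y : x \in p -> e x y -> y \in p.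
  by move=> xp /(adjp _ _ xp) /(seq_adj_index up)[].
pose B := A :\: [set x in p].
have clB x y : x \in B -> e x y -> y \in B.
  rewrite !inE => /andP[xp xA] exy; rewrite (clA _ _ xA exy) andbT.
  by apply: contra xp => /clp; apply; rewrite e_sym.
have leB : #|B| <= n.
  rewrite -ltnS; apply: leq_trans leA; apply: proper_card.
  apply/properP; split; first exact: subsetDl.
  have: 0 < m by apply: maxm; apply: (PS [:: x0]); rewrite /good /= x0A.
  rewrite -szp -has_predT => /hasP[a ap _]; exists a; first exact: pA.
  by rewrite !inE ap.
have [s [es sk ss sadj]] := IHn B leB clB.
exists (p :: s); split=> [|q|q|x y xA exy].
- rewrite /=; apply: uniq_perm; rewrite ?enum_uniq //.
    rewrite cat_uniq up (perm_uniq es) enum_uniq andbT /=.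
    apply/hasPn=> x; rewrite (perm_mem es) mem_enum !inE.
    by case/andP.
  move=> x; rewrite mem_cat (perm_mem es) !mem_enum !inE.
  by case: (boolP (x \in p)) => //= /pA ->.
- by rewrite inE => /predU1P[->|/sk//]; apply: short.
- by rewrite inE => /predU1P[->|/ss//].
- have [xp|xp] := boolP (x \in p).
    by exists p; rewrite ?mem_head //; apply: adjp.
  have [|q qs ?] := sadj x y _ exy; first by rewrite !inE xp.
  by exists q; rewrite // inE qs orbT.
Qed.

Lemma acyclic_linear_forest : k_linear_forest k e.
Proof.
have [|x y _ _|s [es sk ss sadj]] := @closed_linear_forest #|T| setT.
- exact: max_card.
- by rewrite inE.
exists s; split; first by rewrite (permPl es) (eq_enum (B := T)) ?perm_refl // => x;
  rewrite inE.
split=> // x y; split=> [exy|[p ps]]; first by apply: sadj; rewrite ?inE.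
by apply: sorted_seq_adj; apply: ss.
Qed.
End LinearForest.

Lemma edgeless_linear_forest (T : finType) (e : rel T) :
  (forall x y, ~~ e x y) -> k_linear_forest 1 e.
Proof.
move=> e0; apply: acyclic_linear_forest => [x y|x|x [|y p]|x a b c|[|x [|y p]]] //=.
- by rewrite !(negPf (e0 _ _)).
- exact: negPf (e0 _ _).
- by rewrite (negPf (e0 _ _)).
- by rewrite (negPf (e0 _ _)).
Qed.

Lemma matching_linear_forest (T : finType) (e : rel T) :
    symmetric e -> irreflexive e ->
    (forall x a b, e x a -> e x b -> a = b) ->
  k_linear_forest 2 e.
Proof.
move=> e_sym e_irr deg1.
have no3 x y z p : path e x [:: y, z & p] -> uniq [:: x, y, z & p] -> False.
  rewrite /= => /and3P[exy eyz _] /and3P[]; rewrite !inE.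
  by rewrite (deg1 y x z) ?eqxx ?orbT // e_sym.
apply: acyclic_linear_forest => // [x [|y [|z p]] //|x a b c|[|x [|y [|z p]]] //].
- by move=> /no3 H /H.
- by move=> /deg1 xa /xa->; rewrite eqxx.
- by move=> /no3 H /H.
Qed.

(** Walks may repeat vertices: going around a triangle or a 4-cycle is already a nonbacktracking
    walk on 5 vertices, and longer cycles contain a path on 5 vertices. *)
Lemma nonbacktracking_linear_forest (T : finType) (e : rel T) k :
    2 < k -> symmetric e -> irreflexive e ->
    (forall x a b c, e x a -> e x b -> e x c -> [|| a == b, a == c | b == c]) ->
    (forall a b c d f, e a b -> e b c -> e c d -> e d f ->
       a != c -> b != d -> c != f -> False) ->
    (k = 3 -> forall a b c d, e a b -> e b c -> e c d ->
       a != c -> b != d -> False) ->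
  k_linear_forest k e.
Proof.
move=> k3 e_sym e_irr no_claw no5 no4.
apply: acyclic_linear_forest => // [x [|b [|c p]] //|p sp up].
- case: p => [|d [|f p]] /= =>
    [/and3P[xb bc _]|/and4P[xb bc cd _]|/and5P[xb bc cd df _]].
  + rewrite !inE => /and3P[/norP[nxb nxc] nbc _] _; apply/negP => cx.
    by apply: (no5 x b c x b); rewrite // 1?(eq_sym b) 1?(eq_sym c).
  + rewrite !inE => /and4P[/norP[nxb /norP[nxc nxd]] /norP[nbc nbd] ncd _] _.
    by apply/negP => dx; apply: (no5 x b c d x); rewrite // (eq_sym c).
  + rewrite !inE => /and5P[/norP[nxb /norP[nxc _]] /norP[nbc /norP[nbd _]]
      /norP[_ /norP[ncf _]] _ _] _.
    by case: (no5 x b c d f).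
- rewrite leqNgt; apply/negP => kp; have := leq_ltn_trans k3 kp => sz.
  case: p sp up kp sz => [|a [|b [|c [|d p]]]] //= + + + _.
  move=> /and4P[ab bc cd pd].
  rewrite !inE => /and4P[/norP[nab /norP[nac _]] /norP[nbc /norP[nbd _]] nc _] kp.
  case: p pd nc kp => [|f p] pd nc kp.
    by apply: (no4 _ a b c d) => //; apply/eqP; rewrite eqn_leq k3 andbT -ltnS.
  case/andP: pd => df _; apply: (no5 a b c d f) => //.
  by move: nc; rewrite !inE => /norP[_ /norP[]].
Qed.

(** * Pseudoforests *)

(* Orientations of outdegree at most one, [f x = x] meaning that x is a sink. *)
Definition pointer_orientation (T : finType) (e : rel T) (f : T -> T) :=
  [/\ forall x, f x != x -> e x (f x),
      forall x, f (f x) = x -> f x = x &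
      forall x y, e x y -> f x = y \/ f y = x].

(* Reverses the path from x to the sink it leads to. *)
Lemma pointer_reroot (T : finType) (e : rel T) (f : T -> T) n x :
    symmetric e -> irreflexive e ->
    pointer_orientation e f -> f (iter n f x) = iter n f x ->
  exists g, pointer_orientation e g /\ g x = x.
Proof.
move=> e_sym e_irr fo; elim: n x => [|n IHn] x; first by exists f.
rewrite iterSr => fix_n.
have [fxx|fxx] := eqVneq (f x) x; first by exists f.
have [|g [[g1 g2 g3] gfx]] := IHn (f x); first by [].
have exf : e x (f x) by case: fo => f1 _ _; apply: f1.
move: (f x) fxx gfx exf => y yx gy exy.
have gx : g x = y by case: (g3 _ _ exy) => // gyx; rewrite -gyx gy eqxx in yx.
(* In [g] the vertex [y] is a sink and [x] points to it; reversing this one arc makes [x] the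
   sink. *)
exists (fun z => if z == y then x else if z == x then x else g z).
split; last by rewrite eqxx; case: eqP.
split=> [z|z|z w ezw].
- have [->|zy] := eqVneq z y; first by rewrite e_sym.
  by have [->|zx] := eqVneq z x; [rewrite eqxx | apply: g1].
- have [->|zy] := eqVneq z y.
    by rewrite eqxx eq_sym (negPf yx) => ->.
  have [->|zx] := eqVneq z x; first by [].
  have [_ xz|_] := eqVneq (g z) y; first by rewrite xz eqxx in zx.
  by have [_ xz|_] := eqVneq (g z) x; [rewrite xz eqxx in zx | apply: g2].
- have [zy|zy] := eqVneq z y; have [wy|wy] := eqVneq w y.
  + by rewrite zy wy e_irr in ezw.
  + subst z; have [->|wx] := eqVneq w x; first by left.
    by case: (g3 _ _ ezw) => [gyw|]; [rewrite -gyw gy eqxx in wy | right].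
  + subst w; have [->|zx] := eqVneq z x; first by right.
    by case: (g3 _ _ ezw) => [|gyz]; [left | rewrite -gyz gy eqxx in zy].
  + have [zx|zx] := eqVneq z x; have [wx|wx] := eqVneq w x.
    * by rewrite zx wx e_irr in ezw.
    * subst z; case: (g3 _ _ ezw); last by right.
      by rewrite gx => yw; rewrite yw eqxx in wy.
    * subst w; case: (g3 _ _ ezw); first by left.
      by rewrite gx => yw; rewrite yw eqxx in zy.
    * exact: g3.
Qed.

(** Iterating [f] from [x] reaches a sink, and rerooting applies, or runs into a periodic orbit.
    That orbit has at least 3 vertices, since it has no fixed point and no edge is directed both
    ways. *)
Lemma pointer_root_or_cycle (T : finType) (e : rel T) (f : T -> T) x :
    symmetric e -> irreflexive e -> pointer_orientation e f ->
  (exists g, pointer_orientation e g /\ g x = x) \/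
  exists c y, [/\ is_cycle e c, y \in c & connect e x y].
Proof.
move=> e_sym e_irr fo; have [f1 f2 f3] := fo.
have [] := boolP [exists i : 'I_(order f x), f (iter i f x) == iter i f x].
  by case/existsP=> i /eqP fi; left; apply: pointer_reroot fi.
move=> /existsPn nofix; right.
have nofixn n : f (iter n f x) != iter n f x.
  have: fconnect f x (iter n f x) by apply: fconnect_iter.
  move=> /[dup] /findex_max lt /iter_findex <-.
  exact: (nofix (Ordinal lt)).
have en n : e (iter n f x) (iter n.+1 f x) by apply: f1.
have conn n : connect e x (iter n f x).
  by elim: n => // n IHn; apply: connect_trans IHn (connect1 (en n)).
(* The iterate of index [order f x] repeats an earlier one, which is thus periodic. *)
have /trajectP[i lti] := looping_order f x.
set o := order f x in lti *; pose z := iter i f x => Ez.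
have zper : iter (o - i).-1.+1 f z = z.
  by rewrite prednK ?subn_gt0 // /z -iterD subnK // ltnW.
have cz : fcycle f (orbit f z).
  by apply/(orbitPcycle 0 3); exists (o - i).-1.
exists (orbit f z), z; split; [split | exact: in_orbit | exact: conn].
  exact: orbit_uniq.
split.
  rewrite size_orbit ltnNge; apply/negP.
  have oz : iter (order f z) f z = z by apply/(orbitPcycle 0 4).
  have := order_gt0 f z; have := nofixn i; rewrite -/z.
  move: (order f z) oz => [|[|[|m]]] //= E nz _ _.
    by rewrite E eqxx in nz.
  by rewrite (f2 _ E) eqxx in nz.
apply: (sub_in_cycle (P := fconnect f x)) cz.
  move=> u v; rewrite inE => /iter_findex <- _ /eqP<-; exact: en.
apply/allP=> u; rewrite -fconnect_orbit; apply: connect_trans.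
exact: fconnect_iter.
Qed.

Lemma cycle_edgeW (T : finType) (e : rel T) c x y :
  symmetric e -> cycle e c -> cycle_edge c x y -> e x y.
Proof.
move=> e_sym cc /andP[/andP[xc yc]] /orP[]/eqP <-; last rewrite e_sym;
exact: next_cycle.
Qed.

(** The sink [x] is free to point along the new edge, and [y] does not already point to [x], as they
    are not adjacent in [e']. *)
Lemma pointer_add_edge (T : finType) (e : rel T) (g : T -> T) x y :
    symmetric e -> irreflexive e -> x != y ->
    let e' := fun u v => e u v && ~~ ((u == x) && (v == y) || (u == y) && (v == x)) in
    e x y -> pointer_orientation e' g -> g x = x ->
  exists f, pointer_orientation e f.
Proof.
move=> e_sym e_irr xy e' exy [g1 g2 g3] gx.
have gy : g y != x.
  apply/negP => /eqP gy; have := g1 y; rewrite gy => /(_ xy).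
  by rewrite /e' !eqxx orbT andbF.
exists (fun z => if z == x then y else g z); split=> [z|z|z w ezw].
- by have [-> //|zx] := eqVneq z x; move/g1/andP=> [].
- have [->|zx] := eqVneq z x.
    by rewrite eq_sym (negPf xy) => E; rewrite E eqxx in gy.
  have [gz E|_] := eqVneq (g z) x; last exact: g2.
  by rewrite E gz eqxx in gy.
- have [[/eqP zx /eqP wy]|[/eqP zy /eqP wx]|e'zw] :
      [\/ z == x /\ w == y, z == y /\ w == x | e' z w].
    have [|] := boolP (e' z w); first by constructor.
    rewrite /e' ezw negbK => /orP[]/andP[]; first by constructor.
    by constructor 2.
  + by rewrite zx eqxx; left.
  + by rewrite wx eqxx; right.
  + have [zx|zx] := eqVneq z x; have [wx|wx] := eqVneq w x.
    * by rewrite zx wx /e' e_irr in e'zw.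
    * case: (g3 _ _ e'zw); last by right.
      by rewrite zx gx => xw; rewrite -xw eqxx in wx.
    * case: (g3 _ _ e'zw); first by left.
      by rewrite wx gx => xz; rewrite -xz eqxx in zx.
    * exact: g3.
Qed.

Lemma pseudoforest_sub (T : finType) (e e' : rel T) :
  subrel e' e -> pseudoforest e -> pseudoforest e'.
Proof.
move=> sub pf c1 c2 [u1 [s1 cc1]] [u2 [s2 cc2]] [x xc1 [y yc2 xy]].
have cs c : cycle e' c -> cycle e c by apply: sub_cycle.
apply: pf; [by split; auto | by split; auto | exists x => //; exists y => //].
by apply: connect_sub xy => u v /sub /connect1.
Qed.

(* Orient the graph without the edge xy. If x or y can be made a sink, orient xy
   out of it; otherwise x and y both lead to cycles, and these two cycles, or one
   of them and a cycle through xy, contradict uniqueness. *)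
Lemma pseudoforest_pointer (T : finType) (e : rel T) :
    symmetric e -> irreflexive e -> pseudoforest e ->
  exists f, pointer_orientation e f.
Proof.
have [n] := ubnP #|[pred u : T * T | e u.1 u.2]|.
elim: n e => // n IHn e; rewrite ltnS => le_n e_sym e_irr pf.
have [/existsP[[x y] /= exy]|/existsPn e0] :=
  boolP [exists u : T * T, e u.1 u.2]; last first.
  by exists id; split=> // [x|x y exy]; [rewrite eqxx | have := e0 (x, y); rewrite exy].
pose e' u v := e u v && ~~ ((u == x) && (v == y) || (u == y) && (v == x)).
have sub : subrel e' e by move=> u v /andP[].
have e'_sym : symmetric e'.
  by move=> u v; rewrite /e' e_sym; congr (_ && ~~ _); rewrite orbC !(andbC (u == _)).
have e'xy : e' x y = false by rewrite /e' !eqxx andbF.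
have xy : x != y by apply: contraTneq exy => ->; rewrite e_irr.
have e'_irr : irreflexive e' by move=> u; rewrite /e' e_irr.
have [|f fo] := IHn e' _ e'_sym e'_irr (pseudoforest_sub sub pf).
  apply: leq_trans le_n; apply: proper_card; apply/properP.
  by split; [apply/subsetP=> u /sub | exists (x, y); rewrite !inE //= e'xy].
case: (pointer_root_or_cycle x e'_sym e'_irr fo) =>
  [[g [go gx]]|[c [z [Cc zc xz]]]].
  exact: pointer_add_edge go gx.
case: (pointer_root_or_cycle y e'_sym e'_irr fo) =>
  [[g [go gy]]|[c' [z' [Cc' zc' yz']]]].
  apply: (@pointer_add_edge _ e g y x) => //; rewrite 1?eq_sym 1?e_sym //.
  case: go => g1 g2 g3; split=> // [u /g1|u v].
    by rewrite /e' orbC.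
  by move=> H; apply: g3; rewrite /e' orbC.
have up c0 : is_cycle e' c0 -> is_cycle e c0.
  by case=> ? [? H]; split=> //; split=> //; apply: sub_cycle H.
have sub_conn u v : connect e' u v -> connect e u v.
  by apply: connect_sub => a b /sub /connect1.
have [/connectP[p0 /shortenP[p pp up1 _] Ly]|Nxy] := boolP (connect e' x y).
  (* A path from [x] to [y] in [e'] closes up with the removed edge. By uniqueness [c] would contain
     that edge, but [c] lies in [e']. *)
  have Cp : is_cycle e (x :: p).
    split=> //; split; last first.
      rewrite /= rcons_path -Ly e_sym exy andbT.
      exact: sub_path pp.
    case: p pp Ly {up1} => [|a [|b p]] //=; first by move=> _ E; rewrite E eqxx in xy.
    by rewrite andbT => + E; rewrite -E e'xy.
  have: cycle_edge c x y.
    rewrite (pf _ _ (up _ Cc) Cp); last first.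
      by exists z => //; exists x; rewrite ?mem_head // sub_conn //
        (sym_connect_sym e'_sym).
    rewrite /cycle_edge mem_head Ly mem_last -Ly; apply/orP; right.
    by have := cycle_next (proj1 Cp); rewrite /= rcons_path -Ly => /andP[_].
  by move/(cycle_edgeW e'_sym (proj2 (proj2 Cc))); rewrite e'xy.
(* Now [c] and [c'] lie in different components of [e'] that the edge from [x] to [y] joins;
   uniqueness makes them share the vertex [z]. *)
have: cycle_edge c z (next c z) by rewrite /cycle_edge mem_next zc eqxx.
rewrite (pf _ _ (up _ Cc) (up _ Cc')); last first.
  exists z => //; exists z' => //.
  apply: connect_trans (sub_conn _ _ yz'); apply: connect_trans (connect1 exy).
  by apply: sub_conn; rewrite (sym_connect_sym e'_sym).
case/andP=> /andP[zc2 _] _; case/negP: Nxy.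
apply: connect_trans xz _; rewrite (sym_connect_sym e'_sym).
apply: connect_trans yz' _.
exact: connect_cycle (proj2 (proj2 Cc')) _ _ zc' zc2.
Qed.

(* [R s] describes an orientation of outdegree at most one of the double cover
   [bool * T] of [e]: the vertex (s, x) points to (~~ s, y) when [R s x y]. *)
Section DoubleCover.
Variables (T : finType) (e : rel T) (R : bool -> rel T).
Hypothesis e_sym : symmetric e.
Hypothesis R_total : forall s x y, e x y -> R s x y || R (~~ s) y x.
Hypothesis R_asym : forall s x y, R s x y -> ~~ R (~~ s) y x.
Hypothesis R_fun : forall s x y z, R s x y -> R s x z -> y = z.

Lemma next2_neq c x : is_cycle e c -> x \in c -> next c (next c x) != x.
Proof.
move=> [uc [sc _]] xc; apply/eqP => n2.
have fc := cycle_next uc.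
have lt2 : 2 < order (next c) x by rewrite (order_cycle fc uc).
by have := findex_iter lt2; rewrite /= n2 findex0.
Qed.

Lemma iter_next_mem (c : seq T) x n : x \in c -> iter n (next c) x \in c.
Proof. by move=> xc; elim: n => //= n; rewrite mem_next. Qed.

(* If the edge to [next c x] points into (s, x), this propagates backwards along
   the lifted cycle, which returns to (s, x) after [2 * size c] steps. *)
Lemma cover_cycle_step c s x : is_cycle e c -> x \in c ->
  R s x (next c x) || R s x (prev c x).
Proof.
move=> Cc xc; have [//|Nn] /= := boolP (R s x (next c x)).
have [uc [sc cc]] := Cc; pose w i := iter i (next c) x.
have wc i : w i \in c by apply: iter_next_mem.
have ew i : e (w i) (w i.+1) by apply: next_cycle.
(* [w i] is lifted to layer [s (+) odd i]; two turns are needed because an odd cycle returns in the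
   other layer after one. *)
have back i : R (s (+) ~~ odd i) (w i.+1) (w i).
  elim: i => [|i IHi] /=.
    by have := R_total s (ew 0); rewrite (negPf Nn) addbT.
  have := R_total (s (+) ~~ odd i) (ew i.+1).
  rewrite -addbN => /orP[fwd|//].
  by have := next2_neq Cc (wc i); rewrite -[X in _ != X](R_fun fwd IHi) eqxx.
have per : w (size c).*2 = x.
  have fc := cycle_next uc.
  have := iter_order_cycle fc xc xc; rewrite (order_cycle fc uc xc) => per.
  by rewrite /w -addnn iterD !per.
have := back (size c).*2.-1.
have sz : 0 < (size c).*2 by rewrite double_gt0 (ltn_trans _ sc).
have wprev : w (size c).*2.-1 = prev c x.
  by rewrite -[X in prev c X]per -(prednK sz) /w iterS /= prev_next.
have odd_pred : odd (size c).*2.-1.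
  by have := odd_double (size c); rewrite -{1}(prednK sz) /= => /negbFE.
by rewrite prednK // per wprev odd_pred addbF.
Qed.

Lemma cover_cycle_out c s x y : is_cycle e c -> x \in c -> R s x y ->
  (y == next c x) || (y == prev c x).
Proof.
move=> Cc xc xy; case/orP: (cover_cycle_step s Cc xc) => /(R_fun xy)->;
by rewrite eqxx ?orbT.
Qed.

Lemma cover_cycle_closed c s x y : is_cycle e c -> x \in c -> R s x y -> y \in c.
Proof.
move=> Cc xc /(cover_cycle_out Cc xc) /orP[]/eqP->; by rewrite ?mem_next ?mem_prev.
Qed.

(** There are no chords: a chord lifts to an arc out of one of its ends, and arcs out of a cycle
    follow the cycle. *)
Lemma cover_cycle_edge c x y : is_cycle e c -> x \in c -> y \in c ->
  cycle_edge c x y = e x y.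
Proof.
move=> Cc xc yc; have [uc [_ cc]] := Cc; apply/idP/idP.
  exact: cycle_edgeW.
rewrite /cycle_edge xc yc /= => exy.
case/orP: (R_total true exy) => /(cover_cycle_out Cc); move=> /(_ _)/orP[] // /eqP->;
by rewrite ?next_prev ?eqxx ?orbT.
Qed.

Definition cover_step (u v : bool * T) := (v.1 == ~~ u.1) && R u.1 u.2 v.2.

Lemma cover_connect_closed c u v : is_cycle e c -> u.2 \in c ->
  connect cover_step u v -> v.2 \in c.
Proof.
move=> Cc uc /connectP[p pp ->] {v}; elim: p u uc pp => //= v p IHp u uc.
case/andP=> /andP[_ /(cover_cycle_closed Cc uc) vc]; exact: IHp.
Qed.

(** Induction along a path away from [c]. An arc from the new vertex to the old one prepends to the
    old walk; an arc the other way is the only arc out of the old vertex, so the old walk starts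
    with it, or is empty and the new vertex is on [c]. *)
Lemma cover_reach c x y : is_cycle e c -> x \in c -> connect e x y ->
  forall s, exists2 v, v.2 \in c & connect cover_step (s, y) v.
Proof.
move=> Cc xc /connectP[p pp ->] {y}.
have {xc}: forall s, exists2 v : bool * T, v.2 \in c & connect cover_step (s, x) v.
  by move=> s; exists (s, x).
elim: p x pp => //= y p IHp x /andP[exy pp] Qx; apply: IHp pp _ => s.
rewrite e_sym in exy; case/orP: (R_total s exy) => [yx|xy].
  have [v vc xv] := Qx (~~ s); exists v => //.
  by apply: connect_trans xv; apply: connect1; rewrite /cover_step eqxx.
have [v vc /connectP[[|u q] /= pq Dv]] := Qx (~~ s).
  exists (s, y); rewrite ?connect0 //=; apply: cover_cycle_closed Cc _ xy.
  by move: vc; rewrite Dv.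
case/andP: pq => /andP[/eqP /= Du /(R_fun xy) Dy] pq; exists v => //.
apply/connectP; exists q => //.
  by rewrite Dy -[s]negbK -Du -surjective_pairing.
by rewrite Dy -[s]negbK -Du -surjective_pairing.
Qed.

(** Once an arc follows [next c1], the following one cannot turn back, so the walk goes all around
    [c1]; it never leaves [c2]. *)
Lemma cover_cycle_sub_next c1 c2 s z : is_cycle e c1 -> is_cycle e c2 ->
  z \in c1 -> z \in c2 -> R s z (next c1 z) -> {subset c1 <= c2}.
Proof.
move=> C1 C2 z1 z2 zn; have u1 := proj1 C1.
pose w i := iter i (next c1) z.
have fwd i : (w i \in c2) && R (s (+) odd i) (w i) (w i.+1).
  elim: i => [|i /andP[i2 Ri]]; first by rewrite z2 addbF.
  have i12 := cover_cycle_closed C2 i2 Ri; rewrite i12 /=.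
  have i11 : w i.+1 \in c1 by apply: iter_next_mem.
  rewrite addbN; case/orP: (cover_cycle_step (~~ (s (+) odd i)) C1 i11) => //.
  by rewrite {2}/w iterS prev_next // (negPf (R_asym Ri)).
move=> x; rewrite -(fconnect_cycle (cycle_next u1) z1) => /iter_findex <-.
by case/andP: (fwd (findex (next c1) z x)).
Qed.

Lemma cover_cycle_sub c1 c2 z : is_cycle e c1 -> is_cycle e c2 ->
  z \in c1 -> z \in c2 -> {subset c1 <= c2}.
Proof.
move=> C1 C2 z1 z2; case/orP: (cover_cycle_step true C1 z1).
  exact: cover_cycle_sub_next.
have [u1 [s1 cc1]] := C1.
(* If the arc goes backwards, traverse [c1] in reverse. *)
rewrite -next_rev // => /cover_cycle_sub_next sub x x1.
apply: sub C2 _ z2 _ _; rewrite ?mem_rev //.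
split; rewrite ?rev_uniq // size_rev rev_cycle; split=> //.
by apply: sub_cycle cc1 => a b; rewrite e_sym.
Qed.

(** Following arcs from a vertex of [c2] reaches [c1] without leaving [c2]. Cycles with a common
    vertex have the same vertices, hence, being chordless, the same edges. *)
Lemma cover_pseudoforest : pseudoforest e.
Proof.
move=> c1 c2 C1 C2 [x x1 [y y2 xy]] a b.
have [z z1 yz] := cover_reach C1 x1 xy true.
have z2 := @cover_connect_closed _ (true, y) _ C2 y2 yz.
have eq12 u : (u \in c1) = (u \in c2).
  by apply/idP/idP;
    [apply: (cover_cycle_sub C1 C2 z1 z2) | apply: (cover_cycle_sub C2 C1 z2 z1)].
have [a1|a1] := boolP (a \in c1); last by rewrite /cycle_edge -!eq12 (negPf a1).
have [b1|b1] := boolP (b \in c1); last by rewrite /cycle_edge -!eq12 (negPf b1) !andbF.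
by rewrite !cover_cycle_edge -?eq12.
Qed.
End DoubleCover.

(** * Orientations of direct products *)

Definition swap_rel (T1 T2 : finType) (D : rel (T1 * T2)) : rel (T2 * T1) :=
  fun u v => D (u.2, u.1) (v.2, v.1).

Definition functional_orientation (T : finType) (e D : rel T) :=
  is_orientation e D /\ forall v x y, D v x -> D v y -> x = y.

Lemma functional_one_perfectly_orientable (T : finType) (e D : rel T) :
  functional_orientation e D -> one_perfectly_orientable e.
Proof. by case=> oD fD; exists D; split=> // v x y /fD xv /xv ->; rewrite eqxx. Qed.

Lemma swap_orientation (T1 T2 : finType) (e1 : rel T1) (e2 : rel T2) D :
  is_orientation (dprod_rel e1 e2) D ->
  is_orientation (dprod_rel e2 e1) (swap_rel D).
Proof.
by move=> [D1 D2]; split=> [[x y] [x' y'] /D1|[x y] [x' y']];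
  rewrite /dprod_rel /= andbC // => xy; apply: D2.
Qed.

Lemma swap_functional (T1 T2 : finType) (e1 : rel T1) (e2 : rel T2) D :
  functional_orientation (dprod_rel e1 e2) D ->
  functional_orientation (dprod_rel e2 e1) (swap_rel D).
Proof.
move=> [oD fD]; split=> [|v [x y] [x' y'] xy xy']; first exact: swap_orientation.
by case: (fD _ _ _ xy xy') => -> ->.
Qed.

Lemma swap_one_perfectly_orientable (T1 T2 : finType) (e1 : rel T1) (e2 : rel T2) :
  one_perfectly_orientable (dprod_rel e1 e2) ->
  one_perfectly_orientable (dprod_rel e2 e1).
Proof.
case=> D [oD pD]; exists (swap_rel D); split; first exact: swap_orientation.
move=> v [x y] [x' y'] vx vy; rewrite xpair_eqE andbC => ne.
by rewrite /dprod_rel /= andbC; have := pD _ _ _ vx vy ne.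
Qed.

Lemma dprod_orientation_or (T1 T2 : finType) (e1 : rel T1) (e2 : rel T2) D a b x y :
    is_orientation (dprod_rel e1 e2) D -> e1 a b -> e2 x y ->
  D (a, x) (b, y) || D (b, y) (a, x).
Proof.
move=> [_ D2] ab xy; have := D2 (a, x) (b, y); rewrite /dprod_rel /= ab xy.
by move=> /(_ isT) /orP[] /andP[-> _]; rewrite ?orbT.
Qed.

Definition triangle (T : finType) (e : rel T) a b c := [&& e a b, e b c & e c a].
Definition has_triangle (T : finType) (e : rel T) :=
  [exists a, exists b, exists c, triangle e a b c].

Lemma triangle_rot (T : finType) (e : rel T) a b c :
  triangle e a b c -> triangle e b c a.
Proof. by case/and3P=> ab bc ca; apply/and3P. Qed.

Lemma triangle_free_functional (T : finType) (e D : rel T) :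
  symmetric e -> ~~ has_triangle e -> one_perfect_orientation e D ->
  functional_orientation e D.
Proof.
move=> e_sym noT [oD pD]; split=> // v x y vx vy; apply/eqP.
apply: contraNT noT => xy; have [De _] := oD.
apply/existsP; exists v; apply/existsP; exists x; apply/existsP; exists y.
by apply/and3P; split; [apply: De | apply: pD vx vy xy | rewrite e_sym; apply: De].
Qed.

Lemma has_triangle_dprod (T1 T2 : finType) (e1 : rel T1) (e2 : rel T2) :
  has_triangle (dprod_rel e1 e2) -> has_triangle e1 && has_triangle e2.
Proof.
case/existsP=> [[a x]] /existsP[[b y]] /existsP[[c z]] /and3P[].
rewrite /dprod_rel /= => /andP[ab xy] /andP[bc yz] /andP[ca zx].
apply/andP; split.
  by apply/existsP; exists a; apply/existsP; exists b;
    apply/existsP; exists c; apply/and3P.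
by apply/existsP; exists x; apply/existsP; exists y;
  apply/existsP; exists z; apply/and3P.
Qed.

(** * Products of triangles *)

Section TwoTriangles.
Variables (T1 T2 : finType) (e1 : rel T1) (e2 : rel T2) (D : rel (T1 * T2)).
Hypotheses (irr1 : irreflexive e1) (irr2 : irreflexive e2).
Hypotheses (sym1 : symmetric e1) (sym2 : symmetric e2).
Hypothesis opD : one_perfect_orientation (dprod_rel e1 e2) D.

Lemma out_nonadjacent v a b x y : D v (a, x) -> D v (b, y) ->
    ~~ e1 a b || ~~ e2 x y ->
  (a, x) = (b, y).
Proof.
move=> va vb; rewrite -negb_and => ne; apply/eqP; apply: contraNT ne => ne.
exact: (proj2 opD _ _ _ va vb ne).
Qed.

(* In the product of two triangles, each vertex lies on one triangle where both
   coordinates turn the same way (even) and one where they turn opposite ways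
   (odd), and it cannot point along both. [points_along] tells whether it points
   along the even one. Each edge makes one of its ends point along its triangle,
   so every even triangle has at least two vertices pointing along it and every
   odd one at most one: 6 <= count <= 3 over the three triangles of each class. *)
Definition points_along a b c x y z := D (a, x) (b, y) || D (a, x) (c, z).

Lemma points_along_even a b c x y z : triangle e1 a b c -> triangle e2 x y z ->
  points_along a b c x y z || points_along b c a y z x.
Proof.
case/and3P=> ab _ _ /and3P[xy _ _]; rewrite /points_along.
by case/orP: (dprod_orientation_or (proj1 opD) ab xy) => ->; rewrite ?orbT.
Qed.

(** The tail of the edge between [(a, x)] and [(b, z)] cannot point along its even triangle too: the
    other vertices there share a coordinate with the head. *)
Lemma points_along_odd a b c x y z : triangle e1 a b c -> triangle e2 x y z ->
  ~~ points_along a b c x y z || ~~ points_along b c a z x y.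
Proof.
case/and3P=> ab bc ca /and3P[xy yz zx].
rewrite -negb_and; apply/negP => /andP[]; rewrite /points_along => P Q.
have xz : e2 x z by rewrite sym2.
have [axbz|bzax] := orP (dprod_orientation_or (proj1 opD) ab xz).
  case/orP: P => /(out_nonadjacent axbz); rewrite ?irr1 ?irr2 ?orbT => /(_ isT) [].
    by move=> E; move: yz; rewrite E irr2.
  by move=> E; move: bc; rewrite E irr1.
case/orP: Q => /(out_nonadjacent bzax); rewrite ?irr1 ?irr2 ?orbT => /(_ isT) [].
  by move=> E; move: ca; rewrite E irr1.
by move=> E; move: xy; rewrite E irr2.
Qed.

Lemma two_triangles : has_triangle e1 -> has_triangle e2 -> False.
Proof.
case/existsP=> a0 /existsP[a1 /existsP[a2 t0]].
case/existsP=> x0 /existsP[x1 /existsP[x2 s0]].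
have t1 := triangle_rot t0; have t2 := triangle_rot t1.
have s1 := triangle_rot s0; have s2 := triangle_rot s1.
move: (points_along_even t0 s0) (points_along_even t1 s0) (points_along_even t2 s0)
  (points_along_even t0 s1) (points_along_even t1 s1) (points_along_even t2 s1)
  (points_along_even t0 s2) (points_along_even t1 s2) (points_along_even t2 s2)
  (points_along_odd t0 s0) (points_along_odd t1 s0) (points_along_odd t2 s0)
  (points_along_odd t0 s1) (points_along_odd t1 s1) (points_along_odd t2 s1)
  (points_along_odd t0 s2) (points_along_odd t1 s2) (points_along_odd t2 s2).
(* The count is done by enumerating the nine truth values. *)
by do 9!case: (points_along _ _ _ _ _ _) => //=.
Qed.
End TwoTriangles.

(** * Orientations of outdegree at most one of a product *)

Section FunctionalProduct.
Variables (T1 T2 : finType) (e1 : rel T1) (e2 : rel T2) (D : rel (T1 * T2)).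
Hypotheses (sym1 : symmetric e1) (sym2 : symmetric e2).
Hypothesis foD : functional_orientation (dprod_rel e1 e2) D.

Lemma functional_asym u v : D u v -> ~~ D v u.
Proof.
by have [[D1 D2] _] := foD => uv; have := D2 _ _ (D1 _ _ uv); rewrite uv /=;
  case: (D v u).
Qed.

(* The vertex (b, x) lies on the square (a, y), (b, x), (c, y), (b, z), and with
   outdegree at most one a cycle keeps the out-neighbours of its vertices. *)
Lemma square_out a b c x y z : e1 b a -> e1 b c -> a != c ->
  e2 y x -> e2 y z -> x != z -> D (b, x) (a, y) || D (b, x) (c, y).
Proof.
move=> ba bc ac yx yz xz; have [_ fD] := foD.
(* Otherwise [(a, y)] and [(c, y)] both spend their only arc on [(b, x)], so [(b, z)] must point to
   both. *)
rewrite sym2 in yx; apply: contraT; rewrite negb_or => /andP[Na Nc].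
have ab := dprod_orientation_or (proj1 foD) ba yx.
have cb := dprod_orientation_or (proj1 foD) bc yx.
rewrite (negPf Na) (negPf Nc) /= in ab cb.
rewrite sym1 in ba; rewrite sym1 in bc.
case/orP: (dprod_orientation_or (proj1 foD) ba yz) =>
  [/(fD _ _ _ ab) [E]|za]; first by rewrite E eqxx in xz.
case/orP: (dprod_orientation_or (proj1 foD) bc yz) =>
  [/(fD _ _ _ cb) [E]|zc]; first by rewrite E eqxx in xz.
by have [E] := fD _ _ _ za zc; rewrite E eqxx in ac.
Qed.
End FunctionalProduct.

(** Three squares make [(v, x)] point into each pair among [(a, y)], [(b, y)], [(c, y)], but one
    vertex lies in only two of these pairs. *)
Lemma functional_no_claw (T1 T2 : finType) (e1 : rel T1) (e2 : rel T2) D y x z :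
    symmetric e1 -> symmetric e2 ->
    functional_orientation (dprod_rel e1 e2) D ->
    e2 y x -> e2 y z -> x != z ->
  forall v a b c, e1 v a -> e1 v b -> e1 v c -> [|| a == b, a == c | b == c].
Proof.
move=> sym1 sym2 foD yx yz xz v a b c va vb vc; have [_ fD] := foD.
apply: contraT; rewrite !negb_or => /and3P[ab ac bc].
have Sab := square_out sym1 sym2 foD va vb ab yx yz xz.
have Sac := square_out sym1 sym2 foD va vc ac yx yz xz.
have Sbc := square_out sym1 sym2 foD vb vc bc yx yz xz.
have ex u w : u != w -> D (v, x) (u, y) -> D (v, x) (w, y) -> False.
  by move=> uw /fD vu /vu[] E; rewrite E eqxx in uw.
by case/orP: Sab => [Da|Db]; [case/orP: Sbc | case/orP: Sac] => H;
  first [case: (ex _ _ ab Da H) | case: (ex _ _ ac Da H)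
        | case: (ex _ _ ab H Db) | case: (ex _ _ bc Db H)].
Qed.

(* The vertex (c, y) lies on two squares which share no neighbour of it. *)
Lemma functional_no_walk (T1 T2 : finType) (e1 : rel T1) (e2 : rel T2) D y x z :
    symmetric e1 -> symmetric e2 ->
    functional_orientation (dprod_rel e1 e2) D ->
    e2 y x -> e2 y z -> x != z ->
  forall a b c d f, e1 a b -> e1 b c -> e1 c d -> e1 d f ->
    a != c -> b != d -> c != f -> False.
Proof.
move=> sym1 sym2 foD yx yz xz a b c d f ab bc cd df ac bd cf.
have soD := swap_functional foD; have [_ fD] := foD.
rewrite sym1 in ab; rewrite eq_sym in ac.
have Sb := square_out sym2 sym1 soD yx yz xz bc ab ac.
rewrite sym1 in cd.
have Sd := square_out sym2 sym1 soD yx yz xz cd df cf.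
by case/orP: Sb => /fD H1; case/orP: Sd => /H1[] E; rewrite E eqxx in bd.
Qed.

(** Two squares through [(b, x)] have only [(c, y)] as a common neighbour of it, so [(b, x)] points
    there; by symmetry [(c, y)] points back. *)
Lemma functional_no_two_walks (T1 T2 : finType) (e1 : rel T1) (e2 : rel T2) D :
    symmetric e1 -> symmetric e2 ->
    functional_orientation (dprod_rel e1 e2) D ->
  forall a b c d, e1 a b -> e1 b c -> e1 c d -> a != c -> b != d ->
  forall w x y z, e2 w x -> e2 x y -> e2 y z -> w != y -> x != z -> False.
Proof.
move=> sym1 sym2 foD a b c d ab bc cd ac bd w x y z wx xy yz wy xz.
have soD := swap_functional foD; have [_ fD] := foD.
have [ba [cb dc]] : e1 b a /\ e1 c b /\ e1 d c by rewrite (sym1 b) (sym1 c) (sym1 d).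
have [xw [yx zy]] : e2 x w /\ e2 y x /\ e2 z y by rewrite (sym2 x) (sym2 y) (sym2 z).
have bxcy : D (b, x) (c, y).
  have S1 := square_out sym1 sym2 foD ba bc ac yx yz xz.
  have S2 := square_out sym2 sym1 soD xw xy wy cb cd bd.
  case/orP: S1 => // /fD H1.
  by case/orP: S2 => /H1 /(congr1 fst) /= E1; rewrite E1 eqxx in ac.
have cybx : D (c, y) (b, x).
  have S1 := square_out sym1 sym2 foD cb cd bd xy xw; rewrite eq_sym in wy.
  have := S1 wy; rewrite eq_sym in xz.
  have S2 := square_out sym2 sym1 soD yz yx xz bc ba; rewrite eq_sym in ac.
  have := S2 ac.
  move=> P /orP[//|/fD H1].
  by case/orP: P => /H1 /(congr1 fst) /= E1; rewrite E1 eqxx in bd.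
by have := functional_asym foD bxcy; rewrite cybx.
Qed.

Lemma functional_pseudoforest (T1 T2 : finType) (e1 : rel T1) (e2 : rel T2) D a b :
    symmetric e1 -> symmetric e2 ->
    functional_orientation (dprod_rel e1 e2) D -> e1 a b -> pseudoforest e2.
Proof.
move=> sym1 sym2 foD ab; have [_ fD] := foD; have ba := ab; rewrite sym1 in ba.
(* The layers of the double cover are the copies of [T2] over [a] and [b]. *)
pose R s x y := if s then D (a, x) (b, y) else D (b, x) (a, y).
apply: (@cover_pseudoforest _ _ R sym2) => [[]|[]|[]] x y.
- by move=> xy; apply: (dprod_orientation_or (proj1 foD)).
- by move=> xy; apply: (dprod_orientation_or (proj1 foD)).
- exact: (functional_asym foD).
- exact: (functional_asym foD).
- by move=> z /fD xy /xy[].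
- by move=> z /fD xy /xy[].
Qed.

(** * Sufficiency of the three conditions *)

Lemma linear_forest1_edgeless (T : finType) (e : rel T) :
  k_linear_forest 1 e -> forall x y, ~~ e x y.
Proof.
case/linear_forest_pos=> pos [lt adj _] x y; apply/negP => /adj.
by have := lt x; have := lt y; case: (pos x) (pos y) => [|?] [|?].
Qed.

Lemma linear_forest2_matching (T : finType) (e : rel T) : k_linear_forest 2 e ->
  forall x y z, e x y -> e x z -> y = z.
Proof.
case/linear_forest_pos=> pos [lt adj inj] x y z xy xz; apply: (inj x) => //.
have := lt x; have := lt y; have := lt z; have := adj _ _ xy; have := adj _ _ xz.
by case: (pos x) (pos y) (pos z) => [|[|?]] [|[|?]] [|[|?]].
Qed.

Lemma edgeless_orientable (T1 T2 : finType) (e1 : rel T1) (e2 : rel T2) :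
  k_linear_forest 1 e1 -> one_perfectly_orientable (dprod_rel e1 e2).
Proof.
move/linear_forest1_edgeless=> e0; exists (fun _ _ => false).
by split=> //; split=> // x y; rewrite /dprod_rel (negPf (e0 _ _)).
Qed.

(** [(a, x)] points to [(b, f x)], where [b] is the only possible neighbour of [a]. *)
Lemma matching_orientable (T1 T2 : finType) (e1 : rel T1) (e2 : rel T2) :
    symmetric e1 -> symmetric e2 -> irreflexive e2 ->
    k_linear_forest 2 e1 -> pseudoforest e2 ->
  one_perfectly_orientable (dprod_rel e1 e2).
Proof.
move=> sym1 sym2 irr2 /linear_forest2_matching deg1.
case/(pseudoforest_pointer sym2 irr2)=> f [f1 f2 f3].
apply: (@functional_one_perfectly_orientable _ _
  (fun u v => dprod_rel e1 e2 u v && (f u.2 == v.2))).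
split; last first.
  move=> [a x] [b y] [c z] /= /andP[/andP[/= ab _] /eqP<-].
  by case/andP=> /andP[/= /(deg1 _ _ _ ab)<- _] /eqP<-.
split=> [u v /andP[]//|[a x] [b y] /andP[/= ab xy]].
rewrite /dprod_rel /= (sym1 b) (sym2 y) ab xy /=.
have not2 : ~~ ((f x == y) && (f y == x)).
  apply/negP => /andP[/eqP fx /eqP fy]; have := f2 x.
  by rewrite fx => /(_ fy) yx; rewrite yx irr2 in xy.
case: (f3 _ _ xy) not2 => ->; rewrite eqxx ?andbT //= => ->; by rewrite ?orbT.
Qed.

(* The product of a path on 3 vertices and a path on 4 vertices has two
   components, each a square with two pendant edges; [target i j] is the position
   the vertex at position (i, j) points to. *)
Definition target (i j : nat) : nat * nat :=
  if i == 1 then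
    if j == 0 then (2, 1) else if j == 1 then (0, 2)
    else if j == 2 then (0, 1) else (2, 2)
  else if j == 0 then (1, 1) else if j == 3 then (1, 2)
  else if i == 0 then (1, if j == 1 then 0 else 3)
  else (1, if j == 1 then 2 else 1).

Lemma short_paths_orientable (T1 T2 : finType) (e1 : rel T1) (e2 : rel T2) :
    symmetric e1 -> symmetric e2 ->
    k_linear_forest 3 e1 -> k_linear_forest 4 e2 ->
  one_perfectly_orientable (dprod_rel e1 e2).
Proof.
move=> sym1 sym2 /linear_forest_pos[p [ltp adjp injp]].
move=> /linear_forest_pos[q [ltq adjq injq]].
(* On shorter paths the target position may be absent; the vertex is then a sink. *)
pose D u v := dprod_rel e1 e2 u v && (target (p u.1) (q u.2) == (p v.1, q v.2)).
apply: (@functional_one_perfectly_orientable _ _ D).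
split; last first.
  move=> [a x] [b y] [c z] /andP[/andP[/= ab xy] /eqP E].
  case/andP=> /andP[/= ac xz] /=; rewrite E xpair_eqE => /andP[/eqP E1 /eqP E2].
  by rewrite (injp _ _ _ ab ac E1) (injq _ _ _ xy xz E2).
split=> [u v /andP[]//|[a x] [b y] /andP[/= ab xy]].
rewrite /D /dprod_rel /= (sym1 b) (sym2 y) ab xy /=.
have := ltp a; have := ltp b; have := ltq x; have := ltq y.
have := adjp _ _ ab; have := adjq _ _ xy.
case: (p a) (p b) (q x) (q y) => [|[|[|?]]] [|[|[|?]]] //= [|[|[|[|?]]]] [|[|[|[|?]]]] //=.
Qed.

(** * Necessity, by vertices of degree at least two *)

Definition has_branch (T : finType) (e : rel T) :=
  [exists y, exists x, exists z, [&& e y x, e y z & x != z]].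

Lemma has_branchP (T : finType) (e : rel T) :
  reflect (exists y x z, [/\ e y x, e y z & x != z]) (has_branch e).
Proof.
apply: (iffP existsP) => -[y].
  by case/existsP=> x /existsP[z /and3P[]]; exists y, x, z.
case=> x [z H]; exists y; apply/existsP; exists x; apply/existsP; exists z.
exact/and3P.
Qed.

Lemma no_branch (T : finType) (e : rel T) : ~~ has_branch e ->
  forall y x z, e y x -> e y z -> x = z.
Proof.
move=> nb y x z yx yz; apply/eqP; apply: contraNT nb => xz.
by apply/has_branchP; exists y, x, z.
Qed.

Lemma forward_matching (T1 T2 : finType) (e1 : rel T1) (e2 : rel T2) D :
    symmetric e1 -> irreflexive e1 -> symmetric e2 ->
    functional_orientation (dprod_rel e1 e2) D ->
    ~~ has_branch e1 ->
  k_linear_forest 1 e1 \/ (k_linear_forest 2 e1 /\ pseudoforest e2).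
Proof.
move=> sym1 irr1 sym2 foD /no_branch deg1.
have [/existsP[a /existsP[b ab]]|e0] := boolP [exists a, exists b, e1 a b].
  right; split; first exact: matching_linear_forest.
  exact: functional_pseudoforest foD ab.
left; apply: edgeless_linear_forest => a b; apply: contraNN e0 => ab.
by apply/existsP; exists a; apply/existsP; exists b.
Qed.

(** At most one factor has a nonbacktracking walk on 4 vertices; the other gets the bound 3. *)
Lemma forward_paths (T1 T2 : finType) (e1 : rel T1) (e2 : rel T2) D :
    symmetric e1 -> irreflexive e1 -> symmetric e2 -> irreflexive e2 ->
    functional_orientation (dprod_rel e1 e2) D ->
    has_branch e1 -> has_branch e2 ->
  (k_linear_forest 3 e1 /\ k_linear_forest 4 e2) \/
  (k_linear_forest 3 e2 /\ k_linear_forest 4 e1).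
Proof.
move=> sym1 irr1 sym2 irr2 foD /has_branchP[b [a [c [ba bc ac]]]].
case/has_branchP=> y [x [z [yx yz xz]]]; have soD := swap_functional foD.
have claw1 := functional_no_claw sym1 sym2 foD yx yz xz.
have claw2 := functional_no_claw sym2 sym1 soD ba bc ac.
have walk1 := functional_no_walk sym1 sym2 foD yx yz xz.
have walk2 := functional_no_walk sym2 sym1 soD ba bc ac.
have [|no4] := boolP [exists a, exists b, exists c, exists d,
    [&& e1 a b, e1 b c, e1 c d, a != c & b != d]].
  case/existsP=> a' /existsP[b' /existsP[c' /existsP[d' /and5P[ab' bc' cd' ac' bd']]]].
  right; split; apply: nonbacktracking_linear_forest => // _ w x' y' z'.
  exact: functional_no_two_walks sym1 sym2 foD _ _ _ _ ab' bc' cd' ac' bd' w x' y' z'.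
left; split; apply: nonbacktracking_linear_forest => // _ a' b' c' d' ab bc' cd ac' bd.
apply: (negP no4); apply/existsP; exists a'; apply/existsP; exists b'.
by apply/existsP; exists c'; apply/existsP; exists d'; apply/and5P.
Qed.

Theorem theorem11 (T1 T2 : finType) (e1 : rel T1) (e2 : rel T2)
  (G1 : simple_graph e1) (G2 : simple_graph e2)
  (n1 : 1 < #|T1|) (n2 : 1 < #|T2|) :
  one_perfectly_orientable (dprod_rel e1 e2) <->
  [\/ k_linear_forest 1 e1 \/ k_linear_forest 1 e2,
      (k_linear_forest 2 e1 /\ pseudoforest e2) \/
      (k_linear_forest 2 e2 /\ pseudoforest e1)
    | (k_linear_forest 3 e1 /\ k_linear_forest 4 e2) \/
      (k_linear_forest 3 e2 /\ k_linear_forest 4 e1)].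
Proof.
case: G1 G2 => [sym1 irr1] [sym2 irr2]; split; last first.
  case=> [[F1|F2]|[[F1 P2]|[F2 P1]]|[[F1 F2]|[F2 F1]]].
  - exact: edgeless_orientable.
  - exact/swap_one_perfectly_orientable/edgeless_orientable.
  - exact: matching_orientable.
  - exact/swap_one_perfectly_orientable/matching_orientable.
  - exact: short_paths_orientable.
  - exact/swap_one_perfectly_orientable/short_paths_orientable.
case=> D opD; have noT : ~~ has_triangle (dprod_rel e1 e2).
  apply/negP => /has_triangle_dprod /andP[t1 t2].
  exact: two_triangles irr1 irr2 sym2 opD t1 t2.
have sym12 : symmetric (dprod_rel e1 e2).
  by move=> u v; rewrite /dprod_rel sym1 sym2.
have foD := triangle_free_functional sym12 noT opD.
have [br1|nb1] := boolP (has_branch e1); last first.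
  by case: (forward_matching sym1 irr1 sym2 foD nb1) => F;
    [constructor 1 | constructor 2]; left.
have [br2|nb2] := boolP (has_branch e2); last first.
  by case: (forward_matching sym2 irr2 sym1 (swap_functional foD) nb2) => F;
    [constructor 1 | constructor 2]; right.
by constructor 3; apply: forward_paths foD br1 br2.
Qed.
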